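(* Let $n\ge 2$ be an integer and let $\nu$ be an integer with $1<\nu<n$. Put $$A(n,\nu)=-\frac{\pi}{12n}\csc^2\frac{\pi\nu}{n},\qquad B(n,\nu)=-\frac{\pi}{12n}\csc^2\frac{\pi\nu}{n}+\frac{7\pi^3}{1440\,n^3}\left\{1+2\cos^2\frac{\pi\nu}{n}\right\}\csc^4\frac{\pi\nu}{n}.$$ Then $$-\frac{2n}{\pi}\ln\!\left(2\sin\frac{\pi\nu}{n}\right)+A(n,\nu)<\sum_{l=1}^{n-1}\cos\frac{2\pi\nu l}{n}\cdot\csc\frac{\pi l}{n}<-\frac{2n}{\pi}\ln\!\left(2\sin\frac{\pi\nu}{n}\right)+B(n,\nu).$$ *)

(* Defs.v *)
From Stdlib Require Export Reals.
Open Scope R_scope.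

Definition csc (x : R) : R := / sin x.

Definition A (n nu : nat) : R :=
  - (PI / (12 * INR n)) * csc (PI * INR nu / INR n) ^ 2.

Definition B (n nu : nat) : R :=
  - (PI / (12 * INR n)) * csc (PI * INR nu / INR n) ^ 2
  + 7 * PI ^ 3 / (1440 * INR n ^ 3)
    * (1 + 2 * cos (PI * INR nu / INR n) ^ 2)
    * csc (PI * INR nu / INR n) ^ 4.

(* [sum_f 1 (n - 1) f] is f 1 + ... + f (n - 1), both ends included; this
   reading needs 2 <= n, because [sum_f s m f] has (m - s) + 1 terms with
   truncated subtraction. *)
Definition cosec_sum (n nu : nat) : R :=
  sum_f 1 (n - 1)
    (fun l => cos (2 * PI * INR nu * INR l / INR n) * csc (PI * INR l / INR n)).

(* Main.v *)
Require Import Defs.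
From Stdlib Require Import Reals Lra Lia.
From Coquelicot Require Import Coquelicot.
Open Scope R_scope.

(** Write [n = N + 2].  Partial fractions at the [n]-th roots of [-1] give
      [int_0^1 (v^(l-1) + v^(n-l-1)) / (1 + v^n) dv = (PI / n) csc (PI l / n)].
    Summed against [cos (2 PI nu l / n)], with [x = PI nu / n], this turns the cosecant sum into
      [- (2n / PI) (ln (2 sin x) + I)],
      [I = int_0^1 v^(n-1) (1 - v^2) / ((1 + v^n) (1 - 2 v cos (2x) + v^2)) dv].
    For [v = exp (-t)] and [c = cos (2x)], the factor [(1 - v^2) / (1 - 2 v c + v^2)] is
    [sinh t / (cosh t - c)], which lies strictly between
      [t / (1 - c) - t^3 (2 + c) / (6 (1 - c)^2)]  and  [t / (1 - c)].
    It remains to know the moments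
      [J_j (n) = int_0^1 v^(n-1) (- ln v)^j / (1 + v^n) dv],
      [J_1 (n) = PI^2 / (12 n^2)]  and  [J_3 (n) <= 7 PI^4 / (120 n^4)].
    Since [J_j (n) = m^(j+1) J_j (m n)], these follow as [m] tends to infinity, by comparing the
    expansion of [y csc y - 1 = int_0^1 v^(M-1) (1/v - v) / (1 + v^M) dv], [y = PI / M], [M = m n],
    with [1/v - v = 2 sinh t = 2 t + t^3 / 3 + ...]. *)

(** * Finite trigonometric sums *)

Lemma sum_f_R0_exchange (f : nat -> nat -> R) (M N : nat) :
  sum_f_R0 (fun i => sum_f_R0 (fun k => f i k) M) N =
  sum_f_R0 (fun k => sum_f_R0 (fun i => f i k) N) M.
Proof.
induction N as [|N IH]; simpl; [reflexivity|].
rewrite IH, <- plus_sum. reflexivity.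
Qed.

Lemma sum_f_R0_kronecker (f : nat -> R) (N j : nat) :
  sum_f_R0 (fun i => if Nat.eqb i j then f i else 0) N =
  if Nat.leb j N then f j else 0.
Proof.
induction N as [|N IH].
- destruct j; reflexivity.
- rewrite tech5, IH.
  destruct (Nat.leb_spec j N), (Nat.leb_spec j (S N)),
    (Nat.eqb_spec (S N) j); subst; try lia; lra.
Qed.

Lemma is_RInt_sum_f_R0 (f : nat -> R -> R) (I : nat -> R) (a b : R) (N : nat) :
  (forall k, (k <= N)%nat -> is_RInt (f k) a b (I k)) ->
  is_RInt (fun v => sum_f_R0 (fun k => f k v) N) a b (sum_f_R0 I N).
Proof.
induction N as [|N IH]; intros H; simpl.
- apply H; lia.
- apply (is_RInt_plus (V := R_NormedModule)); [apply IH; intros k Hk|]; apply H; lia.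
Qed.

Lemma is_RInt_scal_R (f : R -> R) (a b c I : R) :
  is_RInt f a b I -> is_RInt (fun x => c * f x) a b (c * I).
Proof. exact (is_RInt_scal f a b c I). Qed.

(** The sum telescopes: [2 sin a cos ((2k+1) a) = sin (2(k+1) a) - sin (2k a)]. *)
Lemma sum_cos_odd (a : R) (K : nat) :
  2 * sin a * sum_f_R0 (fun k => cos ((2 * INR k + 1) * a)) K =
  sin (2 * INR (S K) * a).
Proof.
assert (E : forall k, 2 * sin a * cos ((2 * INR k + 1) * a) =
  sin (2 * INR (S k) * a) - sin (2 * INR k * a)).
{ intros k. rewrite S_INR.
  replace (2 * (INR k + 1) * a) with ((2 * INR k + 1) * a + a) by ring.
  replace (2 * INR k * a) with ((2 * INR k + 1) * a - a) by ring.
  rewrite sin_plus, sin_minus. ring. }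
induction K as [|K IH].
- cbn [sum_f_R0]. rewrite E. simpl INR.
  replace (2 * 0 * a) with 0 by ring. rewrite sin_0. ring.
- rewrite tech5, Rmult_plus_distr_l, IH, E. ring.
Qed.

(** Summation by parts, written as one telescoping sum; the second factor [sin a] clears the
    denominator it produces. The weight [n - 2k - 1] is, up to a constant, [PI - th k] for the angle
    [th k = (2k+1) PI / n]. *)
Lemma sum_linear_sin_odd (n a : R) (K : nat) :
  2 * sin a * sum_f_R0 (fun k => (n - 2 * INR k - 1) * sin ((2 * INR k + 1) * a)) K
  * sin a =
  n * sin a - (n - 2 * INR (S K)) * cos (2 * INR (S K) * a) * sin a
    - sin (2 * INR (S K) * a) * cos a.
Proof.
assert (E : forall k,
  2 * sin a * ((n - 2 * INR k - 1) * sin ((2 * INR k + 1) * a)) * sin a =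
  ((n - 2 * INR k) * cos (2 * INR k * a) * sin a + sin (2 * INR k * a) * cos a) -
  ((n - 2 * INR (S k)) * cos (2 * INR (S k) * a) * sin a
     + sin (2 * INR (S k) * a) * cos a)).
{ intros k. rewrite S_INR.
  replace (2 * (INR k + 1) * a) with ((2 * INR k + 1) * a + a) by ring.
  replace (2 * INR k * a) with ((2 * INR k + 1) * a - a) by ring.
  rewrite sin_plus, sin_minus, cos_plus, cos_minus.
  generalize (sin2_cos2 a). unfold Rsqr.
  set (s := sin a). set (c := cos a).
  set (u := sin _). set (w := cos _). intros H.
  ring. }
induction K as [|K IH].
- cbn [sum_f_R0]. rewrite E. simpl INR.
  replace (2 * 0 * a) with 0 by ring. rewrite sin_0, cos_0. ring.
- rewrite tech5, Rmult_plus_distr_l, Rmult_plus_distr_r, IH, E. ring.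
Qed.

(** Imaginary part of the geometric sum of [v^i exp(i(i+1)t)] (imaginary unit in the exponent),
    multiplied by the squared modulus [1 - 2 v cos t + v^2] of [1 - v exp(it)]. The induction only
    uses the three-term recurrence of the sines. *)
Lemma geometric_sin (v t : R) (N : nat) :
  (1 - 2 * v * cos t + v ^ 2) * sum_f_R0 (fun i => v ^ i * sin (INR (S i) * t)) N =
  sin t - v ^ S N * sin (INR (S (S N)) * t) + v ^ S (S N) * sin (INR (S N) * t).
Proof.
assert (E : forall x, sin ((x + 1 + 1) * t) = 2 * cos t * sin ((x + 1) * t) - sin (x * t)).
{ intros x. replace ((x + 1 + 1) * t) with ((x + 1) * t + t) by ring.
  replace (x * t) with ((x + 1) * t - t) by ring.
  rewrite sin_plus, sin_minus. ring. }
induction N as [|N IH].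
- cbn [sum_f_R0]. generalize (E 0). simpl.
  replace ((0 + 1 + 1) * t) with ((1 + 1) * t) by ring.
  replace ((0 + 1) * t) with t by ring. replace (0 * t) with 0 by ring.
  rewrite sin_0, !Rmult_1_l. intros ->. ring.
- rewrite tech5, Rmult_plus_distr_l, IH.
  rewrite (S_INR (S (S N))), (S_INR (S N)), E. simpl pow. ring.
Qed.

(** The real part of the same geometric sum. *)
Lemma geometric_cos (v t : R) (N : nat) :
  (1 - 2 * v * cos t + v ^ 2) * sum_f_R0 (fun i => v ^ i * cos (INR (S i) * t)) N =
  cos t - v - v ^ S N * cos (INR (S (S N)) * t) + v ^ S (S N) * cos (INR (S N) * t).
Proof.
assert (E : forall x, cos ((x + 1 + 1) * t) = 2 * cos t * cos ((x + 1) * t) - cos (x * t)).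
{ intros x. replace ((x + 1 + 1) * t) with ((x + 1) * t + t) by ring.
  replace (x * t) with ((x + 1) * t - t) by ring.
  rewrite cos_plus, cos_minus. ring. }
induction N as [|N IH].
- cbn [sum_f_R0]. generalize (E 0). simpl.
  replace ((0 + 1 + 1) * t) with ((1 + 1) * t) by ring.
  replace ((0 + 1) * t) with t by ring. replace (0 * t) with 0 by ring.
  rewrite cos_0, !Rmult_1_l. intros ->. ring.
- rewrite tech5, Rmult_plus_distr_l, IH.
  rewrite (S_INR (S (S N))), (S_INR (S N)), E. simpl pow. ring.
Qed.

Lemma sin_2INR_PI (k : nat) : sin (2 * INR k * PI) = 0.
Proof. rewrite <- (Rplus_0_l (2 * INR k * PI)), sin_period. apply sin_0. Qed.

Lemma cos_2INR_PI (k : nat) : cos (2 * INR k * PI) = 1.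
Proof. rewrite <- (Rplus_0_l (2 * INR k * PI)), cos_period. apply cos_0. Qed.

Lemma sum_cos_odd_vanish (a : R) (K : nat) :
  sin (2 * INR (S K) * a) = 0 -> sin a <> 0 ->
  sum_f_R0 (fun k => cos ((2 * INR k + 1) * a)) K = 0.
Proof.
intros H0 H. generalize (sum_cos_odd a K). rewrite H0. intros E.
apply Rmult_integral in E. destruct E as [E|E]; [|exact E].
apply Rmult_integral in E. destruct E; lra.
Qed.

(** Discrete orthogonality of sines at the odd multiples of [PI / n], [n = N + 2]. The frequencies
    are [i + 1] and [j + 1]; besides [i = j] they also coincide when they add up to [n], since
    [sin ((2k+1) PI - y) = sin y]. This is the case [i = N - j]. *)
Lemma sum_sin_sin_odd (N i j : nat) (a : R) :
  a = PI / INR (S (S N)) -> (i <= N)%nat -> (j <= N)%nat ->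
  sum_f_R0 (fun k => sin (INR (S i) * ((2 * INR k + 1) * a)) *
                     sin (INR (S j) * ((2 * INR k + 1) * a))) (S N) =
  INR (S (S N)) / 2 * ((if Nat.eqb i j then 1 else 0) +
                       (if Nat.eqb i (N - j) then 1 else 0)).
Proof.
intros Ha Hi Hj.
assert (Hn : 0 < INR (S (S N))) by (apply lt_0_INR; lia).
assert (Hna : INR (S (S N)) * a = PI) by (rewrite Ha; field; lra).
assert (Ha0 : 0 < a).
{ rewrite Ha. apply Rdiv_lt_0_compat; [exact PI_RGT_0|exact Hn]. }
assert (Hsin : forall x, 0 < x < INR (S (S N)) -> sin (x * a) <> 0).
{ intros x Hx. apply Rgt_not_eq, sin_gt_0; [nra|]. rewrite <- Hna. nra. }
assert (Hm : sum_f_R0 (fun k => cos ((2 * INR k + 1) * ((INR i - INR j) * a))) (S N) =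
  if Nat.eqb i j then INR (S (S N)) else 0).
{ destruct (Nat.eqb_spec i j) as [E|E].
  - rewrite (sum_eq _ (fun _ => 1)).
    + rewrite sum_cte. ring.
    + intros k _. subst j. replace (_ * _) with 0 by ring. apply cos_0.
  - apply sum_cos_odd_vanish.
    + destruct (Nat.le_gt_cases j i).
      * replace (2 * INR (S (S N)) * ((INR i - INR j) * a))
          with (2 * INR (i - j) * PI) by (rewrite minus_INR, <- Hna by lia; ring).
        apply sin_2INR_PI.
      * replace (2 * INR (S (S N)) * ((INR i - INR j) * a))
          with (- (2 * INR (j - i) * PI)) by (rewrite minus_INR, <- Hna by lia; ring).
        rewrite sin_neg, sin_2INR_PI. ring.
    + apply le_INR in Hi, Hj. rewrite !S_INR in Hsin.
      generalize (pos_INR i), (pos_INR j). intros.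
      destruct (Nat.lt_total i j) as [L|[L|L]]; [|lia|]; apply lt_INR in L.
      * replace ((INR i - INR j) * a) with (- ((INR j - INR i) * a)) by ring.
        rewrite sin_neg. apply Ropp_neq_0_compat, Hsin. lra.
      * apply Hsin. lra. }
assert (Hp : sum_f_R0 (fun k => cos ((2 * INR k + 1) * ((INR i + INR j + 2) * a))) (S N) =
  if Nat.eqb i (N - j) then - INR (S (S N)) else 0).
{ destruct (Nat.eqb_spec i (N - j)) as [E|E].
  - rewrite (sum_eq _ (fun _ => -1)).
    + rewrite sum_cte. ring.
    + intros k _. subst i.
      replace ((2 * INR k + 1) * ((INR (N - j) + INR j + 2) * a))
        with (PI + 2 * INR k * PI)
        by (rewrite minus_INR, <- Hna, !S_INR by lia; ring).
      rewrite cos_period. apply cos_PI.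
  - apply sum_cos_odd_vanish.
    + replace (2 * INR (S (S N)) * ((INR i + INR j + 2) * a))
        with (2 * INR (i + j + 2) * PI)
        by (rewrite !plus_INR, <- Hna; simpl INR; ring).
      apply sin_2INR_PI.
    + generalize (pos_INR i), (pos_INR j). intros.
      destruct (Nat.lt_total (i + j) N) as [L|[L|L]]; [|lia|].
      * apply Hsin. apply lt_INR in L. rewrite plus_INR in L. rewrite !S_INR. lra.
      (* Here the angle exceeds PI; subtracting PI brings it back to the range of [Hsin]. *)
      * replace ((INR i + INR j + 2) * a)
          with ((INR i + INR j + 2 - INR (S (S N))) * a + PI) by (rewrite <- Hna; ring).
        rewrite neg_sin. apply Ropp_neq_0_compat, Hsin.
        apply lt_INR in L. rewrite plus_INR in L.
        apply le_INR in Hi, Hj. rewrite !S_INR. lra. }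
transitivity (sum_f_R0 (fun k =>
   / 2 * cos ((2 * INR k + 1) * ((INR i - INR j) * a)) -
   / 2 * cos ((2 * INR k + 1) * ((INR i + INR j + 2) * a))) (S N)).
{ apply sum_eq. intros k _. rewrite !S_INR.
  replace ((2 * INR k + 1) * ((INR i - INR j) * a)) with
    ((INR i + 1) * ((2 * INR k + 1) * a) - (INR j + 1) * ((2 * INR k + 1) * a)) by ring.
  replace ((2 * INR k + 1) * ((INR i + INR j + 2) * a)) with
    ((INR i + 1) * ((2 * INR k + 1) * a) + (INR j + 1) * ((2 * INR k + 1) * a)) by ring.
  rewrite cos_plus, cos_minus. field. }
rewrite minus_sum.
rewrite (sum_eq _ (fun k => cos ((2 * INR k + 1) * ((INR i - INR j) * a)) * / 2))
  by (intros; ring).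
rewrite <- scal_sum, Hm.
rewrite (sum_eq _ (fun k => cos ((2 * INR k + 1) * ((INR i + INR j + 2) * a)) * / 2))
  by (intros; ring).
rewrite <- scal_sum, Hp.
destruct (Nat.eqb i j), (Nat.eqb i (N - j)); field.
Qed.

(** * Integral representation of the cosecant sum *)

Lemma is_RInt_derive_R (f df : R -> R) (I : R) :
  (forall x, 0 <= x <= 1 -> is_derive f x (df x)) ->
  (forall x, 0 <= x <= 1 -> continuous df x) ->
  f 1 - f 0 = I -> is_RInt df 0 1 I.
Proof.
intros Hd Hc <-.
apply (is_RInt_derive (V := R_CompleteNormedModule) f df);
  rewrite Rmin_left, Rmax_right by lra; assumption.
Qed.

Lemma is_RInt_minus_R (f g : R -> R) (a b I J : R) :
  is_RInt f a b I -> is_RInt g a b J -> is_RInt (fun x => f x - g x) a b (I - J).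
Proof. exact (is_RInt_minus f g a b I J). Qed.

Lemma cos_lt_1 (t : R) : 0 < t < 2 * PI -> cos t < 1.
Proof.
intros H. replace t with (2 * (t / 2)) by field. rewrite cos_2a_sin.
assert (0 < sin (t / 2)) by (apply sin_gt_0; lra). nra.
Qed.

Lemma poisson_denominator_pos (c v : R) : c < 1 -> 0 <= v -> 0 < 1 - 2 * v * c + v ^ 2.
Proof.
intros Hc Hv. replace (1 - 2 * v * c + v ^ 2) with ((1 - v) ^ 2 + 2 * v * (1 - c)) by ring.
generalize (pow2_ge_0 (1 - v)). intros.
destruct (Req_dec v 0) as [->|]; [lra|nra].
Qed.

(* The antiderivative is the argument of [1 - v exp(-it)], which for [0 <= v <= 1]
   stays within (-PI/2, PI/2). *)
Lemma is_RInt_poisson_sin (t : R) :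
  0 < t < 2 * PI ->
  is_RInt (fun v => sin t / (1 - 2 * v * cos t + v ^ 2)) 0 1 ((PI - t) / 2).
Proof.
intros Ht. generalize (cos_lt_1 t Ht) (sin2_cos2 t). unfold Rsqr. intros Hc Hs.
assert (Hp : forall v, 0 <= v <= 1 -> 0 < 1 - v * cos t) 
  by (intros v Hv; destruct (Req_dec v 0) as [->|]; nra).
apply (is_RInt_derive_R (fun v => atan (v * sin t / (1 - v * cos t)))).
- intros v Hv. generalize (Hp v Hv) (poisson_denominator_pos _ v Hc (proj1 Hv)).
  intros H1 H2.
  assert (H3 : (1 - v * cos t) ^ 2 + (v * sin t) ^ 2 = 1 - 2 * v * cos t + v ^ 2).
  { transitivity (1 - 2 * v * cos t + v ^ 2 * (sin t * sin t + cos t * cos t));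
      [ring|rewrite Hs; ring]. }
  auto_derive; [lra|].
  rewrite <- H3 in *. unfold Rsqr. field.
  repeat split; try lra.
- intros v Hv. apply (ex_derive_continuous (V := R_NormedModule)).
  generalize (poisson_denominator_pos _ v Hc (proj1 Hv)). intros H2.
  auto_derive. simpl in *. lra.
(* At [v = 1] the argument of [atan] is [cot (t / 2) = tan (PI / 2 - t / 2)]. *)
- assert (Hsh : 0 < sin (t / 2)) by (apply sin_gt_0; lra).
  replace (1 * sin t / (1 - 1 * cos t)) with (tan (PI / 2 - t / 2)).
  + rewrite atan_tan by lra. replace (0 * sin t / (1 - 0 * cos t)) with 0 by field.
    rewrite atan_0. field.
  + unfold tan. rewrite sin_shift, cos_shift.
    replace (sin t) with (2 * sin (t / 2) * cos (t / 2))
      by (rewrite <- sin_2a; f_equal; field).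
    replace (cos t) with (1 - 2 * sin (t / 2) * sin (t / 2))
      by (rewrite <- cos_2a_sin; f_equal; field).
    field. split; nra.
Qed.

(* Expand [(v^j + v^(N-j)) / (1 + v^(N+2))] in partial fractions over the roots
   [exp(i(2k+1)a)] of the denominator, then integrate termwise. *)
Lemma is_RInt_csc (N j : nat) :
  (j <= N)%nat ->
  is_RInt (fun v => (v ^ j + v ^ (N - j)) / (1 + v ^ S (S N))) 0 1
    (PI / INR (S (S N)) * csc (PI * INR (S j) / INR (S (S N)))).
Proof.
intros Hj.
set (n := INR (S (S N))). set (a := PI / n).
assert (Hn : 2 <= n).
{ unfold n. rewrite !S_INR. generalize (pos_INR N). lra. }
assert (Hna : n * a = PI) by (unfold a; field; lra).
assert (Ha0 : 0 < a) by (unfold a; apply Rdiv_lt_0_compat; [exact PI_RGT_0|lra]).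
assert (Hk : forall k, (k <= S N)%nat -> 0 < (2 * INR k + 1) * a < 2 * PI).
{ intros k Hk. generalize (pos_INR k). intros. apply le_INR in Hk.
  split; [nra|]. replace (2 * PI) with (2 * n * a) by (rewrite <- Hna; ring).
  apply Rmult_lt_compat_r; [exact Ha0|].
  unfold n. rewrite (S_INR (S N)). lra. }
set (th := fun k => (2 * INR k + 1) * a).
assert (Hsin : 0 < sin (INR (S j) * a)).
{ apply sin_gt_0.
  - apply Rmult_lt_0_compat; [apply lt_0_INR; lia|exact Ha0].
  - rewrite <- Hna. apply Rmult_lt_compat_r; [exact Ha0|]. unfold n. apply lt_INR. lia. }
replace (a * csc (PI * INR (S j) / n)) with
  (sum_f_R0 (fun k => 2 / n * sin (INR (S j) * th k) * ((PI - th k) / 2)) (S N)).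
- apply (is_RInt_ext (fun v => sum_f_R0 (fun k =>
    2 / n * sin (INR (S j) * th k) *
      (sin (th k) / (1 - 2 * v * cos (th k) + v ^ 2))) (S N))).
  + intros v. rewrite Rmin_left, Rmax_right by lra. intros Hv.
    assert (Hpv : 0 < v ^ S (S N)) by (apply pow_lt; lra).
    transitivity (sum_f_R0 (fun k => sum_f_R0 (fun i =>
      2 / n / (1 + v ^ S (S N)) * v ^ i *
        (sin (INR (S i) * th k) * sin (INR (S j) * th k))) N) (S N)).
    * apply sum_eq. intros k Hkn.
      transitivity (2 / n / (1 + v ^ S (S N)) * sin (INR (S j) * th k) *
        sum_f_R0 (fun i => v ^ i * sin (INR (S i) * th k)) N).
      2:{ rewrite scal_sum. apply sum_eq. intros. ring. }
      generalize (poisson_denominator_pos _ v (cos_lt_1 _ (Hk k Hkn)) ltac:(lra)).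
      fold (th k). intros Hq.
      (* As [n * th k] is an odd multiple of PI, the boundary terms collapse and the right side
         becomes [(1 + v^n) sin (th k)]. *)
      generalize (geometric_sin v (th k) N).
      replace (INR (S (S N)) * th k) with (PI + 2 * INR k * PI)
        by (unfold th; rewrite <- Hna; unfold n; ring).
      replace (INR (S N) * th k) with ((PI - th k) + 2 * INR k * PI)
        by (unfold th; rewrite <- Hna; unfold n; rewrite (S_INR (S N)); ring).
      rewrite !sin_period, sin_PI, sin_PI_x. intros E.
      replace (sum_f_R0 _ N) with
        ((1 + v ^ S (S N)) * sin (th k) / (1 - 2 * v * cos (th k) + v ^ 2)).
      { field. repeat split; lra. }
      apply Rmult_eq_reg_l with (1 - 2 * v * cos (th k) + v ^ 2); [|lra].
      rewrite E. field. lra.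
    (* With the sum over [k] inside, orthogonality keeps only the powers [i = j] and [i = N - j]. *)
    * rewrite sum_f_R0_exchange.
      transitivity (sum_f_R0 (fun i => / (1 + v ^ S (S N)) *
        ((if Nat.eqb i j then v ^ i else 0) +
         (if Nat.eqb i (N - j) then v ^ i else 0))) N).
      -- apply sum_eq. intros i Hi.
         rewrite (sum_eq _ (fun k => (sin (INR (S i) * th k) * sin (INR (S j) * th k)) *
            (2 / n / (1 + v ^ S (S N)) * v ^ i))) by (intros; ring).
         rewrite <- scal_sum. unfold th.
         rewrite (sum_sin_sin_odd N i j a eq_refl Hi Hj). fold n.
         destruct (Nat.eqb i j), (Nat.eqb i (N - j)); field; split; lra.
      -- rewrite (sum_eq _ (fun i => ((if Nat.eqb i j then v ^ i else 0) +
           (if Nat.eqb i (N - j) then v ^ i else 0)) * / (1 + v ^ S (S N))))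
           by (intros; ring).
         rewrite <- scal_sum, plus_sum, !sum_f_R0_kronecker.
         rewrite (proj2 (Nat.leb_le j N)), (proj2 (Nat.leb_le (N - j) N)) by lia.
         apply Rmult_comm.
  + apply is_RInt_sum_f_R0. intros k Hkn. apply is_RInt_scal_R.
    apply is_RInt_poisson_sin. apply Hk, Hkn.
- unfold csc. replace (PI * INR (S j) / n) with (INR (S j) * a) by (unfold a; field; lra).
  set (b := INR (S j) * a) in *.
  (* The sum over all [n] roots ends at the angle [2 n b], a multiple of [2 PI], so the right side
     reduces to [2 n sin b]. *)
  generalize (sum_linear_sin_odd n b (S N)). fold n.
  replace (2 * n * b) with (2 * INR (S j) * PI) by (unfold b; rewrite <- Hna; ring).
  rewrite sin_2INR_PI, cos_2INR_PI. intros E.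
  apply Rmult_eq_reg_l with (2 * sin b * sin b * (n / a)).
  2:{ apply Rmult_integral_contrapositive_currified.
      - nra.
      - apply Rgt_not_eq, Rdiv_lt_0_compat; lra. }
  rewrite (sum_eq _ (fun k => ((n - 2 * INR k - 1) * sin ((2 * INR k + 1) * b)) * (a / n))).
  2:{ intros k _. unfold th, b. rewrite <- Hna.
      replace (INR (S j) * ((2 * INR k + 1) * a)) with ((2 * INR k + 1) * (INR (S j) * a))
        by ring.
      field. lra. }
  rewrite <- scal_sum.
  replace (2 * sin b * sin b * (n / a) * (a / n *
     sum_f_R0 (fun k => (n - 2 * INR k - 1) * sin ((2 * INR k + 1) * b)) (S N)))
    with (2 * sin b *
     sum_f_R0 (fun k => (n - 2 * INR k - 1) * sin ((2 * INR k + 1) * b)) (S N) * sin b)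
    by (field; lra).
  rewrite E. fold n. field. lra.
Qed.

Lemma ln_2sin (x : R) : 0 < sin x -> ln (2 * sin x) = ln (2 - 2 * cos (2 * x)) / 2.
Proof.
intros H. rewrite cos_2a_sin.
replace (2 - 2 * (1 - 2 * sin x * sin x)) with ((2 * sin x) * (2 * sin x)) by ring.
rewrite (ln_mult (2 * sin x) (2 * sin x)) by lra. field.
Qed.

(** The source of the logarithm in the theorem: for [c = cos t] the antiderivative is minus the
    logarithm of the modulus of [1 - v exp(it)]. *)
Lemma is_RInt_poisson_cos (c : R) :
  c < 1 ->
  is_RInt (fun v => (c - v) / (1 - 2 * v * c + v ^ 2)) 0 1 (- (ln (2 - 2 * c) / 2)).
Proof.
intros Hc.
apply (is_RInt_derive_R (fun v => - (ln (1 - 2 * v * c + v ^ 2) / 2))).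
- intros v Hv. generalize (poisson_denominator_pos _ v Hc (proj1 Hv)). intros H.
  auto_derive; simpl in *; [lra|]. field. lra.
- intros v Hv. apply (ex_derive_continuous (V := R_NormedModule)).
  generalize (poisson_denominator_pos _ v Hc (proj1 Hv)). intros H2.
  auto_derive. simpl in *. lra.
- replace (1 - 2 * 0 * c + 0 ^ 2) with 1 by ring.
  replace (1 - 2 * 1 * c + 1 ^ 2) with (2 - 2 * c) by ring. rewrite ln_1. field.
Qed.

Lemma cosec_sum_sum_f_R0 (N nu : nat) :
  cosec_sum (S (S N)) nu =
  sum_f_R0 (fun i => cos (INR (S i) * (2 * (PI * INR nu / INR (S (S N))))) *
                     csc (PI * INR (S i) / INR (S (S N)))) N.
Proof.
unfold cosec_sum, sum_f.
replace (S (S N) - 1 - 1)%nat with N by lia.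
apply sum_eq. intros i _. rewrite Nat.add_1_r. f_equal. f_equal.
field. apply not_0_INR. lia.
Qed.

(** Half the cosecant integrals, summed against the cosines, are subtracted from the integral giving
    [- ln (2 sin x)]. Since [2 n x] is a multiple of [2 PI], the geometric sum starts with [c - v],
    [c = cos (2x)]; this cancels, and only the terms [v^(n-1) - v^(n+1)] remain in the numerator. *)
Lemma cosec_sum_RInt (N nu : nat) :
  (0 < nu < S (S N))%nat ->
  let n := INR (S (S N)) in let x := PI * INR nu / n in
  is_RInt (fun v => v ^ S N * (1 - v ^ 2) /
      ((1 + v ^ S (S N)) * (1 - 2 * v * cos (2 * x) + v ^ 2))) 0 1
    (- (ln (2 * sin x)) - PI / (2 * n) * cosec_sum (S (S N)) nu).
Proof.
intros Hnu n x.
assert (Hn : 2 <= n).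
{ unfold n. rewrite !S_INR. generalize (pos_INR N). lra. }
assert (Hx : 0 < x < PI).
{ assert (0 < INR nu < n) by (split; [apply lt_0_INR|apply lt_INR]; lia).
  generalize PI_RGT_0; intros. unfold x. split.
  - apply Rdiv_lt_0_compat; nra.
  - apply Rmult_lt_reg_r with n; [lra|].
    replace (PI * INR nu / n * n) with (PI * INR nu) by (field; lra). nra. }
assert (Hs : 0 < sin x) by (apply sin_gt_0; lra).
assert (Hc : cos (2 * x) < 1) by (apply cos_lt_1; lra).
assert (Hper : INR (S (S N)) * (2 * x) = 2 * INR nu * PI).
{ unfold x, n. field. fold n. lra. }
assert (Hsum : is_RInt (fun v => sum_f_R0 (fun i => cos (INR (S i) * (2 * x)) *
    ((v ^ i + v ^ (N - i)) / (1 + v ^ S (S N)))) N) 0 1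
    (sum_f_R0 (fun i => cos (INR (S i) * (2 * x)) *
       (PI / n * csc (PI * INR (S i) / n))) N)).
{ apply is_RInt_sum_f_R0. intros i Hi. apply is_RInt_scal_R, is_RInt_csc, Hi. }
generalize (is_RInt_minus_R _ _ _ _ _ _ (is_RInt_poisson_cos _ Hc)
  (is_RInt_scal_R _ _ _ (/ 2) _ Hsum)).
rewrite <- (ln_2sin x Hs). intros H.
replace (_ - _) with (- ln (2 * sin x) - (/ 2 *
  (sum_f_R0 (fun i => cos (INR (S i) * (2 * x)) *
       (PI / n * csc (PI * INR (S i) / n))) N))).
- revert H. apply is_RInt_ext. intros v. rewrite Rmin_left, Rmax_right by lra. intros Hv.
  assert (Hpv : 0 < v ^ S (S N)) by (apply pow_lt; lra).
  generalize (poisson_denominator_pos _ v Hc ltac:(lra)). intros Hq.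
  assert (E : sum_f_R0 (fun i => cos (INR (S i) * (2 * x)) *
      ((v ^ i + v ^ (N - i)) / (1 + v ^ S (S N)))) N =
    2 / (1 + v ^ S (S N)) * sum_f_R0 (fun i => v ^ i * cos (INR (S i) * (2 * x))) N).
  (* The reflection [i -> N - i] replaces [l = i + 1] by [n - l] and preserves the cosine, so both
     powers contribute equally. *)
  { transitivity (/ (1 + v ^ S (S N)) *
      (sum_f_R0 (fun i => v ^ i * cos (INR (S i) * (2 * x))) N +
       sum_f_R0 (fun i => v ^ (N - i) * cos (INR (S (N - i)) * (2 * x))) N)).
    - rewrite <- plus_sum, scal_sum. apply sum_eq. intros i Hi.
      replace (INR (S (N - i)) * (2 * x)) with (- (INR (S i) * (2 * x)) + 2 * INR nu * PI).
      + rewrite cos_period, cos_neg. field. lra.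
      + rewrite <- Hper. unfold n. rewrite !S_INR, minus_INR by lia. ring.
    - rewrite (sum_f_R0_skip (fun i => v ^ i * cos (INR (S i) * (2 * x)))). field. lra. }
  rewrite E. clear E. generalize (geometric_cos v (2 * x) N).
  rewrite Hper. replace (INR (S N) * (2 * x)) with (- (2 * x) + 2 * INR nu * PI)
    by (rewrite <- Hper; unfold n; rewrite (S_INR (S N)); ring).
  rewrite cos_period, cos_neg, cos_2INR_PI. intros E.
  match goal with |- context [sum_f_R0 ?f N] => set (s := sum_f_R0 f N) in * end.
  replace s with ((cos (2 * x) - v - v ^ S N * 1 + v ^ S (S N) * cos (2 * x)) /
    (1 - 2 * v * cos (2 * x) + v ^ 2)) by (rewrite <- E; field; lra).
  match goal with |- ?l = ?r => change (@eq R l r) end.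
  simpl pow. simpl pow in Hpv, Hq. field. lra.
- f_equal.
  rewrite cosec_sum_sum_f_R0. fold n. fold x.
  rewrite (sum_eq _ (fun i => (cos (INR (S i) * (2 * x)) * csc (PI * INR (S i) / n)) * (PI / n)))
    by (intros; ring).
  rewrite <- scal_sum. field. lra.
Qed.

(** * Bounds on the Poisson kernel *)

(** Mean value theorem. The exponential inequalities below iterate it: each expression vanishes at 0
    and its derivative is, up to a positive factor, the next one, until positivity is evident. *)
Lemma pos_of_derive_pos (f df : R -> R) :
  (forall x, 0 <= x -> is_derive f x (df x)) -> f 0 = 0 ->
  (forall x, 0 < x -> 0 < df x) -> forall x, 0 < x -> 0 < f x.
Proof.
intros Hd H0 Hp x Hx.
destruct (MVT_cor2 f df 0 x Hx) as [c [E Hc]].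
{ intros c Hc. apply is_derive_Reals, Hd, Hc. }
rewrite H0 in E. generalize (Hp c (proj1 Hc)). nra.
Qed.

Ltac exp_derive := intros; auto_derive; [exact I|field].
Ltac exp_at_0 := rewrite ?Ropp_0, ?exp_0; field.

Lemma exp_minus_exp_opp_pos (t : R) : 0 < t -> 0 < exp t - exp (- t).
Proof. intros Ht. generalize (exp_increasing (- t) t). lra. Qed.

Lemma sinh_gt_cubic (t : R) : 0 < t -> 2 * t + t ^ 3 / 3 < exp t - exp (- t).
Proof.
intros Ht. apply Rlt_0_minus. revert t Ht.
apply pos_of_derive_pos with (fun t => exp t + exp (- t) - 2 - t ^ 2);
  [exp_derive|exp_at_0|].
apply pos_of_derive_pos with (fun t => exp t - exp (- t) - 2 * t);
  [exp_derive|exp_at_0|].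
apply pos_of_derive_pos with (fun t => exp t + exp (- t) - 2);
  [exp_derive|exp_at_0|].
apply pos_of_derive_pos with (fun t => exp t - exp (- t));
  [exp_derive|exp_at_0|].
exact exp_minus_exp_opp_pos.
Qed.

(** The third-order Taylor remainder of [2 sinh t] is [t^3 / 3] times an intermediate value of
    [cosh], which is below [exp t]. *)
Lemma sinh_lt_cubic (t : R) :
  0 < t -> exp t - exp (- t) < 2 * t + t ^ 3 / 3 * exp t.
Proof.
intros Ht. apply Rlt_0_minus. revert t Ht.
apply pos_of_derive_pos with
  (fun t => 2 + (t ^ 2 + t ^ 3 / 3 - 1) * exp t - exp (- t));
  [exp_derive|exp_at_0|].
apply pos_of_derive_pos with
  (fun t => (2 * t + 2 * t ^ 2 + t ^ 3 / 3 - 1) * exp t + exp (- t));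
  [exp_derive|exp_at_0|].
apply pos_of_derive_pos with
  (fun t => (1 + 6 * t + 3 * t ^ 2 + t ^ 3 / 3) * exp t - exp (- t));
  [exp_derive|exp_at_0|].
intros t Ht. generalize (exp_minus_exp_opp_pos t Ht) (exp_pos t) (pow_lt t 3 Ht).
intros. nra.
Qed.

(** This is [tanh (t/2) < t/2] without denominators, as [tanh (t/2) = sinh t / (cosh t + 1)]. *)
Lemma tanh_half_lt (t : R) :
  0 < t -> 0 < t * (exp t + exp (- t)) + 2 * t - 2 * (exp t - exp (- t)).
Proof.
revert t.
apply pos_of_derive_pos with
  (fun t => t * (exp t - exp (- t)) + 2 - (exp t + exp (- t)));
  [exp_derive|exp_at_0|].
apply pos_of_derive_pos with (fun t => t * (exp t + exp (- t)));
  [exp_derive|exp_at_0|].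
intros t Ht. generalize (exp_pos t) (exp_pos (- t)). intros. nra.
Qed.

(** Here [a = 1 - c]. Without denominators the claim is affine in [a], so the ends suffice: at
    [a = 0] it is [cosh t > 1], at [a = 2] it is [tanh_half_lt]. *)
Lemma poisson_kernel_upper (a t : R) :
  0 < a <= 2 -> 0 < t ->
  (exp t - exp (- t)) / (exp t + exp (- t) - 2 + 2 * a) < t / a.
Proof.
intros Ha Ht.
generalize (tanh_half_lt t Ht) (sinh_gt_cubic t Ht) (pow_lt t 3 Ht). intros H1 H2 H3.
assert (0 < exp t + exp (- t) - 2) by nra.
apply Rmult_lt_reg_r with (a * (exp t + exp (- t) - 2 + 2 * a)); [nra|].
replace (_ / _ * _) with (a * (exp t - exp (- t))) by (field; lra).
replace (t / a * _) with (t * (exp t + exp (- t) - 2 + 2 * a)) by (field; lra).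
nra.
Qed.

(** The value at [a = 2] of the quadratic behind the lower kernel bound. *)
Lemma poisson_kernel_lower_at_2 (t : R) : 0 < t ->
  0 < 24 * (exp t - exp (- t)) - 24 * t + 2 * t ^ 3 + (t ^ 3 - 12 * t) * (exp t + exp (- t)).
Proof.
revert t.
apply pos_of_derive_pos with
  (fun t => 12 * (exp t + exp (- t)) - 24 + 6 * t ^ 2 + 3 * t ^ 2 * (exp t + exp (- t))
            + (t ^ 3 - 12 * t) * (exp t - exp (- t)));
  [exp_derive|exp_at_0|].
apply pos_of_derive_pos with
  (fun t => t * (12 + 6 * t * (exp t - exp (- t)) + (t ^ 2 - 6) * (exp t + exp (- t))));
  [exp_derive|exp_at_0|].
intros t Ht. apply Rmult_lt_0_compat; [exact Ht|]. revert t Ht.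
apply pos_of_derive_pos with
  (fun t => 8 * t * (exp t + exp (- t)) + t ^ 2 * (exp t - exp (- t)));
  [exp_derive|exp_at_0|].
intros t Ht. generalize (exp_minus_exp_opp_pos t Ht) (exp_pos t) (exp_pos (- t)) (pow_lt t 2 Ht).
intros. nra.
Qed.

(** Minus the derivative in [a], at [a = 2], of the same quadratic. *)
Lemma poisson_kernel_lower_slope (t : R) : 0 < t ->
  0 < (6 * t + t ^ 3) * (exp t + exp (- t)) + 36 * t - 24 * (exp t - exp (- t)).
Proof.
revert t.
apply pos_of_derive_pos with
  (fun t => (3 * t ^ 2 - 18) * (exp t + exp (- t)) + (6 * t + t ^ 3) * (exp t - exp (- t)) + 36);
  [exp_derive|exp_at_0|].
apply pos_of_derive_pos with
  (fun t => (12 * t + t ^ 3) * (exp t + exp (- t)) + (6 * t ^ 2 - 12) * (exp t - exp (- t)));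
  [exp_derive|exp_at_0|].
apply pos_of_derive_pos with
  (fun t => 9 * t ^ 2 * (exp t + exp (- t)) + (24 * t + t ^ 3) * (exp t - exp (- t)));
  [exp_derive|exp_at_0|].
intros t Ht. generalize (exp_minus_exp_opp_pos t Ht) (exp_pos t) (exp_pos (- t))
  (pow_lt t 2 Ht) (pow_lt t 3 Ht).
intros. apply Rplus_lt_0_compat; apply Rmult_lt_0_compat; lra.
Qed.

(* After clearing denominators the claim is a convex quadratic in [a], which is
   expanded around [a = 2]: there it is positive and decreasing. *)
Lemma poisson_kernel_lower (a t : R) :
  0 < a <= 2 -> 0 < t ->
  t / a - t ^ 3 * (3 - a) / (6 * a ^ 2) <
  (exp t - exp (- t)) / (exp t + exp (- t) - 2 + 2 * a).
Proof.
intros Ha Ht.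
generalize (poisson_kernel_lower_at_2 t Ht) (poisson_kernel_lower_slope t Ht)
  (sinh_gt_cubic t Ht) (tanh_half_lt t Ht) (pow_lt t 3 Ht). intros H1 H2 H3 H4 H5.
assert (0 < exp t + exp (- t) - 2) by nra.
apply Rmult_lt_reg_r with (6 * a ^ 2 * (exp t + exp (- t) - 2 + 2 * a));
  [apply Rmult_lt_0_compat; nra|].
replace ((exp t - exp (- t)) / _ * _) with (6 * a ^ 2 * (exp t - exp (- t)))
  by (field; lra).
replace ((_ - _) * _) with ((6 * a * t - t ^ 3 * (3 - a)) * (exp t + exp (- t) - 2 + 2 * a))
  by (field; lra).
apply Rlt_0_minus.
set (s := exp t - exp (- t)) in *. set (c := exp t + exp (- t)) in *.
replace (_ - _) with
  ((6 * s - 12 * t - 2 * t ^ 3) * (2 - a) ^ 2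
   + ((6 * t + t ^ 3) * c + 36 * t - 24 * s) * (2 - a)
   + (24 * s - 24 * t + 2 * t ^ 3 + (t ^ 3 - 12 * t) * c)) by ring.
generalize (pow2_ge_0 (2 - a)). intros H6.
assert (0 <= (6 * s - 12 * t - 2 * t ^ 3) * (2 - a) ^ 2) by (apply Rmult_le_pos; lra).
assert (0 <= ((6 * t + t ^ 3) * c + 36 * t - 24 * s) * (2 - a)) by (apply Rmult_le_pos; lra).
lra.
Qed.

(** * Logarithmic moments *)

(** The Archimedean property as a passage to the limit in [m]; it removes the error terms from the
    moment estimates. *)
Lemma le_of_le_plus_div (X Y K : R) :
  (forall m : nat, X <= Y + K / INR (S m)) -> X <= Y.
Proof.
intros H. apply Rnot_lt_le. intros HXY.
destruct (INR_unbounded (K / (X - Y))) as [m Hm].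
specialize (H m). rewrite S_INR in H. generalize (pos_INR m). intros Hm0.
apply (Rmult_lt_compat_r (X - Y)) in Hm; [|lra].
replace (K / (X - Y) * (X - Y)) with K in Hm by (field; lra).
apply (Rmult_le_compat_r (INR m + 1)) in H; [|lra].
replace ((Y + K / (INR m + 1)) * (INR m + 1)) with (Y * (INR m + 1) + K) in H
  by (field; lra).
nra.
Qed.

(** Start of [y csc y = 1 + y^2/6 + 7 y^4/360 + ...], with a generous last coefficient to absorb the
    tail. It follows from the degree 7 Taylor lower bound for [sin y]. *)
Lemma csc_taylor_upper (y : R) :
  0 < y <= 1 -> y * csc y - 1 <= y ^ 2 / 6 + 7 * y ^ 4 / 360 + y ^ 6.
Proof.
intros Hy. generalize PI_RGT_0 PI2_1. intros.
destruct (sin_bound y 1) as [H1 _]; [lra|lra|].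
unfold sin_approx, sin_term in H1. simpl in H1.
assert (Hs : y * (1 - y ^ 2 / 6 + y ^ 4 / 120 - y ^ 6 / 5040) <= sin y).
{ eapply Rle_trans; [|exact H1]. right. simpl. field. }
clear H1. set (z := y ^ 2) in *.
assert (Hz : 0 < z <= 1) by (unfold z; nra).
replace (y ^ 4) with (z ^ 2) in * by (unfold z; ring).
replace (y ^ 6) with (z ^ 3) in * by (unfold z; ring).
assert (Hp : 0 < 1 - z / 6 + z ^ 2 / 120 - z ^ 3 / 5040) by nra.
assert (Hsp : 0 < sin y) by (apply sin_gt_0; lra).
unfold csc. apply Rmult_le_reg_r with (sin y); [exact Hsp|].
replace ((y * / sin y - 1) * sin y) with (y - sin y) by (field; lra).
(* The terms in [z] and [z^2] of the product cancel, so its excess over 1 is divisible by [z^3],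
   with leading coefficient close to 1. *)
assert (Hq : 1 <= (1 + z / 6 + 7 * z ^ 2 / 360 + z ^ 3) *
    (1 - z / 6 + z ^ 2 / 120 - z ^ 3 / 5040)).
{ apply Rminus_le_0.
  replace (_ - _) with (z ^ 3 * ((1 - 7 / 2160 + 1 / 720 - 1 / 5040)
    + z * (- 1 / 6 + 7 / 43200 - 1 / 30240) + z ^ 2 * (1 / 120 - 7 / 1814400)
    - z ^ 3 * (1 / 5040))) by field.
  apply Rmult_le_pos; [apply pow_le; lra|].
  assert (0 <= z ^ 2) by nra. assert (z ^ 3 <= 1) by (simpl; nra). lra. }
assert (0 < 1 + z / 6 + 7 * z ^ 2 / 360 + z ^ 3).
{ generalize (pow_lt z 2 (proj1 Hz)) (pow_lt z 3 (proj1 Hz)). lra. }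
nra.
Qed.

Lemma csc_taylor_lower (y : R) :
  0 < y <= 1 -> y ^ 2 / 6 <= y * csc y - 1.
Proof.
intros Hy. generalize PI_RGT_0 PI2_1. intros.
destruct (sin_bound y 0) as [_ H1]; [lra|lra|].
unfold sin_approx, sin_term in H1. simpl in H1.
assert (Hs : sin y <= y * (1 - y ^ 2 / 6 + y ^ 4 / 120)).
{ eapply Rle_trans; [exact H1|]. right. simpl. field. }
clear H1. set (z := y ^ 2) in *.
assert (Hz : 0 < z <= 1) by (unfold z; nra).
replace (y ^ 4) with (z ^ 2) in * by (unfold z; ring).
assert (Hsp : 0 < sin y) by (apply sin_gt_0; lra).
unfold csc. apply Rmult_le_reg_r with (sin y); [exact Hsp|].
replace ((y * / sin y - 1) * sin y) with (y - sin y) by (field; lra).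
assert (Hq : (1 + z / 6) * (1 - z / 6 + z ^ 2 / 120) <= 1).
{ apply Rminus_le_0. replace (_ - _) with (z ^ 2 * (7 / 360 - z / 720)) by field.
  apply Rmult_le_pos; nra. }
nra.
Qed.

(** * Existence and scaling of the moments *)

Lemma exp_ge_monomial (u : R) (m : nat) : 0 <= u -> u ^ m / INR (Factorial.fact m) <= exp u.
Proof.
intros Hu. eapply Rle_trans; [|exact (exp_ge_taylor u m Hu)].
assert (Hp : forall k, 0 <= u ^ k / INR (Factorial.fact k)).
{ intros k. apply Rdiv_le_0_compat; [apply pow_le, Hu|apply INR_fact_lt_0]. }
destruct m as [|m]; [apply Rle_refl|].
rewrite tech5. generalize (cond_pos_sum _ m Hp). lra.
Qed.

Lemma ln_nonpos (x : R) : x <= 0 -> ln x = 0.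
Proof. intros H. unfold ln. destruct (Rlt_dec 0 x); [exfalso; lra|reflexivity]. Qed.

(* At [0] this uses the convention [ln x = 0] for [x <= 0]. *)
Lemma continuous_mult_ln_pow (j : nat) (x : R) :
  (1 <= j)%nat -> 0 <= x -> continuous (fun v => v * (- ln v) ^ j) x.
Proof.
intros Hj Hx. destruct (Rle_lt_or_eq_dec _ _ Hx) as [Hx'|<-].
- apply (ex_derive_continuous (V := R_NormedModule)). auto_derive. tauto.
- apply filterlim_locally. intros eps.
  assert (Hf : 0 < INR (Factorial.fact (S j))) by apply INR_fact_lt_0.
  (* This radius forces [u = - ln v > (j+1)! / eps], whence [v u^j = u^j exp (- u) <= (j+1)! / u <
     eps]. *)
  assert (H1 : 0 < exp (- (INR (Factorial.fact (S j)) / eps))) by apply exp_pos.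
  exists (mkposreal _ H1). intros v Hv.
  change (Rabs (v - 0) < exp (- (INR (Factorial.fact (S j)) / eps))) in Hv.
  change (Rabs (v * (- ln v) ^ j - 0 * (- ln 0) ^ j) < eps).
  rewrite Rminus_0_r in Hv. rewrite Rmult_0_l, Rminus_0_r.
  (* The neighbourhood of 0 is two-sided; for [v <= 0] the function vanishes because [ln v = 0] and
     [j >= 1]. *)
  destruct (Rle_or_lt v 0) as [Hv0|Hv0].
  { rewrite (ln_nonpos v Hv0), Ropp_0, pow_i, Rmult_0_r, Rabs_R0 by lia. apply cond_pos. }
  rewrite Rabs_pos_eq in Hv by lra.
  set (u := - ln v).
  assert (Hu : INR (Factorial.fact (S j)) / eps < u).
  { unfold u. apply ln_increasing in Hv; [|exact Hv0]. rewrite ln_exp in Hv. lra. }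
  assert (Hep : 0 < INR (Factorial.fact (S j)) / eps).
  { apply Rdiv_lt_0_compat; [exact Hf|apply cond_pos]. }
  assert (Hvu : v = / exp u).
  { rewrite <- exp_Ropp. unfold u. rewrite Ropp_involutive, exp_ln; lra. }
  assert (Hup : 0 < u ^ j) by (apply pow_lt; lra).
  rewrite Rabs_pos_eq by (rewrite Hvu; apply Rmult_le_pos;
    [apply Rlt_le, Rinv_0_lt_compat, exp_pos|lra]).
  generalize (exp_ge_monomial u (S j) ltac:(lra)) (exp_pos u). intros He Hex.
  rewrite Hvu. apply Rmult_lt_reg_l with (exp u); [exact Hex|].
  rewrite <- Rmult_assoc, Rinv_r, Rmult_1_l by lra.
  apply Rlt_le_trans with (u ^ S j / INR (Factorial.fact (S j)) * eps).
  + replace (u ^ S j / INR (Factorial.fact (S j)) * eps) with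
      (u ^ j * (u / (INR (Factorial.fact (S j)) / eps))).
    * rewrite <- (Rmult_1_r (u ^ j)) at 1. apply Rmult_lt_compat_l; [exact Hup|].
      apply Rmult_lt_reg_r with (INR (Factorial.fact (S j)) / eps); [exact Hep|].
      replace (u / _ * _) with u; [lra|]. generalize (cond_pos eps). intros. field. lra.
    * simpl pow. generalize (cond_pos eps). intros. field. lra.
  + apply Rmult_le_compat_r; [apply Rlt_le, cond_pos|exact He].
Qed.

(** One factor [v] is split off [v^k] to tame the logarithm at 0. *)
Lemma continuous_log_moment (j k m : nat) (x : R) :
  (1 <= j)%nat -> (1 <= k)%nat -> 0 <= x ->
  continuous (fun v => v ^ k * (- ln v) ^ j / (1 + v ^ m)) x.
Proof.
intros Hj Hk Hx.
apply (continuous_ext (fun v => (v * (- ln v) ^ j) * (v ^ (k - 1) * / (1 + v ^ m)))).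
{ intros v. destruct k as [|k]; [lia|]. rewrite Nat.sub_succ, Nat.sub_0_r.
  unfold Rdiv. simpl. ring. }
apply (continuous_mult (K := R_AbsRing)); [apply continuous_mult_ln_pow; assumption|].
apply (ex_derive_continuous (V := R_NormedModule)). auto_derive.
assert (0 <= x ^ m) by (apply pow_le, Hx). lra.
Qed.

(** The moment [J_j (n)] with [n = k + 1]: the index is the exponent [n - 1]. *)
Definition log_moment (j k : nat) : R :=
  RInt (fun v => v ^ k * (- ln v) ^ j / (1 + v ^ S k)) 0 1.

Lemma ex_RInt_01 (f : R -> R) :
  (forall x, 0 <= x <= 1 -> continuous f x) -> ex_RInt f 0 1.
Proof.
intros H. apply (ex_RInt_continuous (V := R_CompleteNormedModule)).
rewrite Rmin_left, Rmax_right by lra. exact H.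
Qed.

Lemma is_RInt_log_moment (j k : nat) :
  (1 <= j)%nat -> (1 <= k)%nat ->
  is_RInt (fun v => v ^ k * (- ln v) ^ j / (1 + v ^ S k)) 0 1 (log_moment j k).
Proof.
intros Hj Hk. apply (RInt_correct (V := R_CompleteNormedModule)), ex_RInt_01.
intros x Hx. apply continuous_log_moment; [assumption..|lra].
Qed.

(** Substitute [v^(m+1)] for [v]: each logarithm and the differential contribute a factor [m + 1].
    The new index is [(m+1)(k+1) - 1]. *)
Lemma log_moment_scale (j k m : nat) :
  (1 <= j)%nat -> (1 <= k)%nat ->
  log_moment j k = INR (S m) ^ S j * log_moment j (S m * S k - 1).
Proof.
intros Hj Hk. symmetry. unfold log_moment at 2.
set (f := fun v => v ^ k * (- ln v) ^ j / (1 + v ^ S k)).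
transitivity (RInt f (0 ^ S m) (1 ^ S m)).
2:{ rewrite pow_i, pow1 by lia. reflexivity. }
rewrite <- (RInt_comp f (fun v => v ^ S m) (fun v => INR (S m) * v ^ m)).
- symmetry. apply (is_RInt_unique (V := R_CompleteNormedModule)).
  refine (is_RInt_ext _ _ _ _ _ _ (is_RInt_scal_R _ 0 1 _ _ (is_RInt_log_moment j _ Hj _))).
  2:{ nia. }
  rewrite Rmin_left, Rmax_right by lra. intros v Hv.
  change (INR (S m) ^ S j * (v ^ (S m * S k - 1) * (- ln v) ^ j /
    (1 + v ^ S (S m * S k - 1))) = INR (S m) * v ^ m * f (v ^ S m)).
  unfold f. rewrite ln_pow by lra.
  replace (- (INR (S m) * ln v)) with (INR (S m) * - ln v) by ring.
  rewrite Rpow_mult_distr, <- !pow_mult.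
  replace (S (S m * S k - 1)) with (S m * S k)%nat by lia.
  replace (S m * S k - 1)%nat with (m + S m * k)%nat by lia.
  rewrite pow_add.
  assert (0 < v ^ (S m * S k)) by (apply pow_lt; lra).
  change (INR (S m) ^ S j) with (INR (S m) * INR (S m) ^ j). field. lra.
- rewrite Rmin_left, Rmax_right by lra. intros x Hx.
  apply continuous_log_moment; [assumption..|]. apply pow_le; lra.
- intros x _. split.
  + auto_derive; [exact I|]. rewrite Rmult_1_l. reflexivity.
  + apply (ex_derive_continuous (V := R_NormedModule)). auto_derive. exact I.
Qed.

(** * Evaluation of the moments by comparison with the cosecant *)

(** Case [j = 0] of [is_RInt_csc]: subtracting 1 from [(1 + v^(n-2)) / (1 + v^n)] leaves
    [(v^(n-2) - v^n) / (1 + v^n)]. *)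
Lemma is_RInt_csc_minus_1 (N : nat) :
  let y := PI / INR (S (S N)) in
  is_RInt (fun v => v ^ S N * (/ v - v) / (1 + v ^ S (S N))) 0 1 (y * csc y - 1).
Proof.
intros y.
assert (H1 : is_RInt (fun _ => 1) 0 1 1).
{ apply (is_RInt_derive_R (fun v => v)); [|intros; apply continuous_const|ring].
  intros. apply (is_derive_id (K := R_AbsRing)). }
generalize (is_RInt_minus_R _ _ _ _ _ _ (is_RInt_csc N 0 ltac:(lia)) H1).
replace (PI * INR 1 / INR (S (S N))) with y by (unfold y; change (INR 1) with 1; field; apply not_0_INR; lia).
apply is_RInt_ext. rewrite Rmin_left, Rmax_right by lra. intros v Hv.
rewrite Nat.sub_0_r.
assert (0 < v ^ S (S N)) by (apply pow_lt; lra).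
match goal with |- ?l = ?r => change (@eq R l r) end.
simpl in *. field. lra.
Qed.

Lemma is_RInt_le_01 (f g : R -> R) (I J : R) :
  is_RInt f 0 1 I -> is_RInt g 0 1 J ->
  (forall v, 0 < v < 1 -> f v <= g v) -> I <= J.
Proof. intros Hf Hg H. exact (is_RInt_le f g 0 1 I J Rle_0_1 Hf Hg H). Qed.

Lemma neg_ln_exp (v : R) : 0 < v < 1 ->
  0 < - ln v /\ exp (- ln v) = / v /\ exp (- - ln v) = v.
Proof.
intros Hv. rewrite Ropp_involutive, exp_Ropp, exp_ln by lra.
repeat split. generalize (ln_increasing v 1 (proj1 Hv) (proj2 Hv)). rewrite ln_1. lra.
Qed.

(** With [u = - ln v], [1/v - v = 2 sinh u], and [sinh_gt_cubic] is integrated. *)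
Lemma log_moment_1_3_le_csc (N : nat) :
  let y := PI / INR (S (S N)) in
  2 * log_moment 1 (S N) + / 3 * log_moment 3 (S N) <= y * csc y - 1.
Proof.
intros y.
refine (is_RInt_le_01 _ _ _ _ (is_RInt_plus (V := R_NormedModule) _ _ _ _ _ _
  (is_RInt_scal_R _ _ _ 2 _ (is_RInt_log_moment 1 (S N) _ _))
  (is_RInt_scal_R _ _ _ (/ 3) _ (is_RInt_log_moment 3 (S N) _ _)))
  (is_RInt_csc_minus_1 N) _); try lia.
intros v Hv. destruct (neg_ln_exp v Hv) as [Hu [E1 E2]].
generalize (sinh_gt_cubic _ Hu). rewrite E1, E2.
set (u := - ln v) in *. intros H.
assert (Hp : 0 < v ^ S N / (1 + v ^ S (S N))).
{ assert (0 < v ^ S (S N)) by (apply pow_lt; lra).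
  apply Rdiv_lt_0_compat; [apply pow_lt|]; lra. }
unfold plus; simpl AbelianMonoid.plus; cbv beta.
apply Rle_trans with (v ^ S N / (1 + v ^ S (S N)) * (2 * u + u ^ 3 / 3)).
- right. unfold Rdiv. change (v ^ S (S N)) with (v * v ^ S N).
  match goal with |- ?l = ?r => change (@eq R l r) end. simpl. ring.
- replace (v ^ S N * (/ v - v) / (1 + v ^ S (S N))) with
    (v ^ S N / (1 + v ^ S (S N)) * (/ v - v)) by (unfold Rdiv; ring).
  apply Rmult_le_compat_l; lra.
Qed.

Lemma log_moment_pos (j k : nat) : (1 <= j)%nat -> (1 <= k)%nat -> 0 <= log_moment j k.
Proof.
intros Hj Hk. apply (is_RInt_ge_0 (fun v => v ^ k * (- ln v) ^ j / (1 + v ^ S k)) 0 1).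
- lra.
- apply is_RInt_log_moment; assumption.
- intros v Hv. destruct (neg_ln_exp v Hv) as [Hu _].
  assert (0 < v ^ S k) by (apply pow_lt; lra).
  apply Rdiv_le_0_compat; [apply Rmult_le_pos; apply pow_le|]; lra.
Qed.

(** The factor [exp u = 1/v] in [sinh_lt_cubic] costs one power of [v]. With [z = v^r] and
    [w = v^(r+1)], the crude bound [z^2 / (1 + w^2) <= 2 z / (1 + w)] turns the cubic term into a
    moment at half the order. The loss is harmless, as only the first moment is drawn from this
    bound. *)
Lemma csc_le_log_moment (r : nat) :
  (1 <= r)%nat ->
  let y := PI / INR (2 * S r) in
  y * csc y - 1 <= 2 * log_moment 1 (2 * S r - 1) + 2 / 3 * log_moment 3 r.
Proof.
intros Hr y.
assert (En : (2 * S r)%nat = S (S (2 * r))) by lia.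
generalize (is_RInt_csc_minus_1 (2 * r)). rewrite <- En. fold y. intros Hc.
refine (is_RInt_le_01 _ _ _ _ Hc (is_RInt_plus (V := R_NormedModule) _ _ _ _ _ _
  (is_RInt_scal_R _ _ _ 2 _ (is_RInt_log_moment 1 (2 * S r - 1) _ _))
  (is_RInt_scal_R _ _ _ (2 / 3) _ (is_RInt_log_moment 3 r _ _))) _); try lia.
intros v Hv. destruct (neg_ln_exp v Hv) as [Hu [E1 E2]].
generalize (sinh_lt_cubic _ Hu). rewrite E1, E2.
set (u := - ln v) in *. intros H.
change (v ^ S (2 * r) * (/ v - v) / (1 + v ^ (2 * S r)) <=
  2 * (v ^ (2 * S r - 1) * u ^ 1 / (1 + v ^ S (2 * S r - 1))) +
  2 / 3 * (v ^ r * u ^ 3 / (1 + v ^ S r))).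
replace (S (2 * S r - 1)) with (2 * S r)%nat by lia.
replace (2 * S r - 1)%nat with (S (2 * r)) by lia.
replace (v ^ (2 * S r)) with (v ^ S r * v ^ S r) by (rewrite <- pow_add; f_equal; lia).
replace (v ^ S (2 * r)) with (v * (v ^ r * v ^ r))
  by (rewrite <- pow_add; change (v * v ^ (r + r)) with (v ^ S (r + r)); f_equal; lia).
set (w := v ^ S r). set (z := v ^ r).
assert (Hz : 0 < z < 1).
{ split; [apply pow_lt; lra|]. apply pow_lt_1_compat; [lra|lia]. }
assert (Hw : 0 < w < 1).
{ split; [apply pow_lt; lra|]. apply pow_lt_1_compat; [lra|lia]. }
assert (Hu3 : 0 < u ^ 3) by (apply pow_lt; exact Hu).
apply Rle_trans with (2 * (v * (z * z) * u ^ 1 / (1 + w * w)) + z * z * u ^ 3 / 3 / (1 + w * w)).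
- replace (2 * _ + _) with (v * (z * z) * (2 * u + u ^ 3 / 3 * / v) / (1 + w * w))
    by (field; nra).
  unfold Rdiv at 1 2. apply Rmult_le_compat_r; [apply Rlt_le, Rinv_0_lt_compat; nra|].
  apply Rmult_le_compat_l; [|lra]. apply Rmult_le_pos; nra.
- apply Rplus_le_compat_l.
  replace (2 / 3 * _) with (z * u ^ 3 / 3 * (2 / (1 + w))) by (field; lra).
  replace (z * z * u ^ 3 / 3 / (1 + w * w)) with (z * u ^ 3 / 3 * (z / (1 + w * w)))
    by (field; nra).
  apply Rmult_le_compat_l; [nra|].
  apply Rmult_le_reg_r with ((1 + w) * (1 + w * w)); [nra|].
  replace (z / _ * _) with (z * (1 + w)) by (field; nra).
  replace (2 / _ * _) with (2 * (1 + w * w)) by (field; lra). nra.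
Qed.

(** The two comparisons at [M = mu n], multiplied by [mu^4]: scaling gives
    [mu^4 J_1 (M) = mu^2 J_1 (n)] and [mu^4 J_3 (M) = J_3 (n)]. The factor 4 in [mu] makes [M] even
    and keeps [y <= 1]. The moment at [M / 2] costs a further [2^4], whence [32/3]. *)
Lemma scaled_csc_bounds (k m : nat) :
  (1 <= k)%nat ->
  let n := INR (S k) in
  let mu := 4 * INR (S m) in
  let y := PI / (mu * n) in
  0 < y <= 1 /\
  2 * log_moment 1 k * mu ^ 2 + / 3 * log_moment 3 k <= mu ^ 4 * (y * csc y - 1) /\
  mu ^ 4 * (y * csc y - 1) <= 2 * log_moment 1 k * mu ^ 2 + 32 / 3 * log_moment 3 k.
Proof.
intros Hk n mu y.
set (N := (S (4 * m + 3) * S k)%nat). set (r := (S (2 * m + 1) * S k - 1)%nat).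
assert (EN : N = S (S (N - 2))) by lia.
assert (Er : N = (2 * S r)%nat) by lia.
assert (Emu : INR (S (4 * m + 3)) = mu).
{ unfold mu. replace (S (4 * m + 3)) with (4 * S m)%nat by lia.
  rewrite mult_INR. f_equal. simpl. ring. }
assert (Emu2 : INR (S (2 * m + 1)) = mu / 2).
{ unfold mu. replace (S (2 * m + 1)) with (2 * S m)%nat by lia.
  rewrite mult_INR. change (INR 2) with 2. field. }
assert (EyN : PI / INR N = y) by (unfold y, N; rewrite mult_INR, Emu; reflexivity).
assert (Hn : 2 <= n).
{ change 2 with (INR 2). apply le_INR. lia. }
assert (Hmu : 4 <= mu).
{ unfold mu. rewrite S_INR. generalize (pos_INR m). lra. }
generalize (log_moment_scale 1 k (4 * m + 3) ltac:(lia) Hk)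
  (log_moment_scale 3 k (4 * m + 3) ltac:(lia) Hk)
  (log_moment_scale 3 k (2 * m + 1) ltac:(lia) Hk).
rewrite Emu, Emu2. fold N r. intros S1 S3 S3'.
split; [|split].
- split; unfold y.
  + apply Rdiv_lt_0_compat; [exact PI_RGT_0|nra].
  + apply Rmult_le_reg_r with (mu * n); [nra|].
    replace (PI / (mu * n) * (mu * n)) with PI by (field; lra).
    generalize PI_4. nra.
- generalize (log_moment_1_3_le_csc (N - 2)). rewrite <- EN.
  replace (S (N - 2)) with (N - 1)%nat by lia. rewrite EyN. intros H.
  rewrite S1, S3.
  replace (2 * _ * _ + _) with
    (mu ^ 4 * (2 * log_moment 1 (N - 1) + / 3 * log_moment 3 (N - 1))) by ring.
  apply Rmult_le_compat_l; [apply pow_le; lra|exact H].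
- generalize (csc_le_log_moment r ltac:(lia)). rewrite <- Er, EyN. intros H.
  rewrite S1, S3'.
  replace (2 * _ * _ + _) with
    (mu ^ 4 * (2 * log_moment 1 (N - 1) + 2 / 3 * log_moment 3 r)) by field.
  apply Rmult_le_compat_l; [apply pow_le; lra|exact H].
Qed.

Lemma inv_sq_le_inv (m : nat) : 0 < / (4 * INR (S m)) ^ 2 <= / INR (S m).
Proof.
assert (1 <= INR (S m)) by (rewrite S_INR; generalize (pos_INR m); lra).
split; [apply Rinv_0_lt_compat, pow_lt; lra|].
apply Rinv_le_contravar; [lra|nra].
Qed.

(** Since [mu^4 y^2 / 6 = 2 mu^2 PI^2 / (12 n^2)], dividing the scaled bounds by [2 mu^2] leaves
    errors of order [mu^(-2)], which vanish in the limit. *)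
Lemma log_moment_1 (k : nat) :
  (1 <= k)%nat -> log_moment 1 k = PI ^ 2 / (12 * INR (S k) ^ 2).
Proof.
intros Hk. set (n := INR (S k)).
assert (Hn : 2 <= n).
{ change 2 with (INR 2). apply le_INR. lia. }
apply Rle_antisym.
(* The Taylor tail is at most [2 y^4], and [mu^4 * 2 y^4 = 2 PI^4 / n^4]. *)
- apply le_of_le_plus_div with (PI ^ 4 / n ^ 4). intros m.
  destruct (scaled_csc_bounds k m Hk) as [Hy [H _]]. fold n in Hy, H.
  generalize (csc_taylor_upper _ Hy) (inv_sq_le_inv m) (log_moment_pos 3 k ltac:(lia) Hk).
  set (mu := 4 * INR (S m)) in *. set (y := PI / (mu * n)) in *. intros H1 H2 H3.
  assert (Hmu : 4 <= mu).
  { unfold mu. rewrite S_INR. generalize (pos_INR m). lra. }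
  assert (H4 : y ^ 6 <= y ^ 4).
  { replace (y ^ 6) with (y ^ 4 * y ^ 2) by ring.
    assert (0 <= y ^ 4) by (apply pow_le; lra). assert (y ^ 2 <= 1) by nra. nra. }
  assert (H5 : y * csc y - 1 <= y ^ 2 / 6 + 2 * y ^ 4).
  { assert (0 <= y ^ 4) by (apply pow_le; lra). lra. }
  assert (H6 : mu ^ 4 * (y * csc y - 1) <= mu ^ 4 * (y ^ 2 / 6 + 2 * y ^ 4)).
  { apply Rmult_le_compat_l; [apply pow_le; lra|exact H5]. }
  replace (mu ^ 4 * (y ^ 2 / 6 + 2 * y ^ 4)) with
    (2 * mu ^ 2 * (PI ^ 2 / (12 * n ^ 2) + PI ^ 4 / n ^ 4 * / mu ^ 2)) in H6
    by (unfold y; field; lra).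
  apply Rle_trans with (PI ^ 2 / (12 * n ^ 2) + PI ^ 4 / n ^ 4 * / mu ^ 2).
  + apply Rmult_le_reg_l with (2 * mu ^ 2); [nra|]. lra.
  + apply Rplus_le_compat_l. apply Rmult_le_compat_l; [|apply H2].
    apply Rlt_le, Rdiv_lt_0_compat; apply pow_lt; [exact PI_RGT_0|lra].
- apply le_of_le_plus_div with (16 / 3 * log_moment 3 k). intros m.
  destruct (scaled_csc_bounds k m Hk) as [Hy [_ H]]. fold n in Hy, H.
  generalize (csc_taylor_lower _ Hy) (inv_sq_le_inv m) (log_moment_pos 3 k ltac:(lia) Hk).
  set (mu := 4 * INR (S m)) in *. set (y := PI / (mu * n)) in *. intros H1 H2 H3.
  assert (Hmu : 4 <= mu).
  { unfold mu. rewrite S_INR. generalize (pos_INR m). lra. }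
  assert (H6 : mu ^ 4 * (y ^ 2 / 6) <= mu ^ 4 * (y * csc y - 1)).
  { apply Rmult_le_compat_l; [apply pow_le; lra|exact H1]. }
  replace (mu ^ 4 * (y ^ 2 / 6)) with (2 * mu ^ 2 * (PI ^ 2 / (12 * n ^ 2))) in H6
    by (unfold y; field; lra).
  apply Rle_trans with (log_moment 1 k + 16 / 3 * log_moment 3 k * / mu ^ 2).
  + apply Rmult_le_reg_l with (2 * mu ^ 2); [nra|].
    replace (2 * mu ^ 2 * (log_moment 1 k + 16 / 3 * log_moment 3 k * / mu ^ 2))
      with (2 * log_moment 1 k * mu ^ 2 + 32 / 3 * log_moment 3 k) by (field; lra).
    lra.
  + apply Rplus_le_compat_l. apply Rmult_le_compat_l; [lra|apply H2].
Qed.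

(** With the first moment exact, the [mu^2] terms cancel. The [y^4] term gives the bound, and
    [3 mu^4 y^6 = 3 PI^6 / (n^6 mu^2)] is the vanishing error. *)
Lemma log_moment_3_le (k : nat) :
  (1 <= k)%nat -> log_moment 3 k <= 7 * PI ^ 4 / (120 * INR (S k) ^ 4).
Proof.
intros Hk. set (n := INR (S k)).
assert (Hn : 2 <= n).
{ change 2 with (INR 2). apply le_INR. lia. }
apply le_of_le_plus_div with (3 * PI ^ 6 / n ^ 6). intros m.
destruct (scaled_csc_bounds k m Hk) as [Hy [H _]]. fold n in Hy, H.
generalize (csc_taylor_upper _ Hy) (inv_sq_le_inv m).
rewrite (log_moment_1 k Hk) in H. fold n in H.
set (mu := 4 * INR (S m)) in *. set (y := PI / (mu * n)) in *. intros H1 H2.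
assert (Hmu : 4 <= mu).
{ unfold mu. rewrite S_INR. generalize (pos_INR m). lra. }
assert (H6 : mu ^ 4 * (y * csc y - 1) <= mu ^ 4 * (y ^ 2 / 6 + 7 * y ^ 4 / 360 + y ^ 6)).
{ apply Rmult_le_compat_l; [apply pow_le; lra|exact H1]. }
replace (mu ^ 4 * (y ^ 2 / 6 + 7 * y ^ 4 / 360 + y ^ 6)) with
  (2 * (PI ^ 2 / (12 * n ^ 2)) * mu ^ 2 +
   / 3 * (7 * PI ^ 4 / (120 * n ^ 4) + 3 * PI ^ 6 / n ^ 6 * / mu ^ 2)) in H6
  by (unfold y; field; lra).
apply Rle_trans with (7 * PI ^ 4 / (120 * n ^ 4) + 3 * PI ^ 6 / n ^ 6 * / mu ^ 2); [lra|].
apply Rplus_le_compat_l. apply Rmult_le_compat_l; [|apply H2].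
apply Rlt_le, Rdiv_lt_0_compat; [|apply pow_lt; lra].
generalize (pow_lt PI 6 PI_RGT_0). lra.
Qed.

(** * Integrated kernel bounds and conclusion *)

Lemma poisson_kernel_neg_ln (v c : R) :
  0 < v < 1 -> c < 1 ->
  let u := - ln v in
  (1 - v ^ 2) / (1 - 2 * v * c + v ^ 2) =
  (exp u - exp (- u)) / (exp u + exp (- u) - 2 + 2 * (1 - c)).
Proof.
intros Hv Hc u. destruct (neg_ln_exp v Hv) as [_ [E1 E2]]. fold u in E1, E2.
rewrite E1, E2. generalize (poisson_denominator_pos c v Hc ltac:(lra)). intros H.
field. split; lra.
Qed.

(** The kernel bounds at [a = 1 - c], [t = - ln v], integrated against [v^k / (1 + v^(k+1))]. *)
Lemma poisson_moment_bounds (k : nat) (c I : R) :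
  (1 <= k)%nat -> -1 <= c < 1 ->
  is_RInt (fun v => v ^ k * (1 - v ^ 2) /
      ((1 + v ^ S k) * (1 - 2 * v * c + v ^ 2))) 0 1 I ->
  / (1 - c) * log_moment 1 k - (2 + c) / (6 * (1 - c) ^ 2) * log_moment 3 k < I /\
  I < / (1 - c) * log_moment 1 k.
Proof.
intros Hk Hc HI.
set (f := fun v => v ^ k * (1 - v ^ 2) / ((1 + v ^ S k) * (1 - 2 * v * c + v ^ 2))) in HI.
assert (H1 := is_RInt_scal_R _ _ _ (/ (1 - c)) _ (is_RInt_log_moment 1 k ltac:(lia) Hk)).
assert (H3 := is_RInt_scal_R _ _ _ ((2 + c) / (6 * (1 - c) ^ 2)) _
  (is_RInt_log_moment 3 k ltac:(lia) Hk)).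
assert (H13 := is_RInt_minus_R _ _ _ _ _ _ H1 H3).
assert (C1 : forall d j x, (1 <= j)%nat -> 0 <= x <= 1 ->
  continuous (fun v => d * (v ^ k * (- ln v) ^ j / (1 + v ^ S k))) x).
{ intros d j x Hj Hx. apply (continuous_scal_r (V := R_NormedModule) d).
  apply continuous_log_moment; [assumption..|lra]. }
assert (Cf : forall x, 0 <= x <= 1 -> continuous f x).
{ intros x Hx. apply (ex_derive_continuous (V := R_NormedModule)). unfold f. auto_derive.
  generalize (poisson_denominator_pos c x ltac:(lra) ltac:(lra)). intros Hq.
  assert (0 <= x ^ S k) by (apply pow_le; lra). simpl in *. nra. }
assert (Ef : forall v, 0 < v < 1 -> let u := - ln v in 0 < u /\ f v =
   v ^ k / (1 + v ^ S k) * ((exp u - exp (- u)) / (exp u + exp (- u) - 2 + 2 * (1 - c)))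
   /\ 0 < v ^ k / (1 + v ^ S k)).
{ intros v Hv u. assert (0 < v ^ S k) by (apply pow_lt; lra).
  generalize (poisson_denominator_pos c v ltac:(lra) ltac:(lra)). intros Hq.
  split; [apply neg_ln_exp, Hv|]. split.
  - unfold u. rewrite <- poisson_kernel_neg_ln by lra. unfold f. field. lra.
  - apply Rdiv_lt_0_compat; [apply pow_lt|]; lra. }
apply (is_RInt_unique (V := R_CompleteNormedModule)) in HI, H1, H13.
rewrite <- HI at 1. rewrite <- HI. rewrite <- H13, <- H1.
(* Continuity on the closed interval keeps the inequalities strict under the integral. *)
split; (apply RInt_lt; [lra| | |]).
- exact Cf.
- intros x Hx. apply (continuous_minus (V := R_NormedModule)); apply C1; [lia|lra|lia|lra].
- intros v Hv. destruct (Ef v Hv) as [Hu [-> Hp]].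
  generalize (poisson_kernel_lower (1 - c) _ ltac:(lra) Hu). set (u := - ln v) in *. intros H.
  apply (Rmult_lt_compat_l _ _ _ Hp) in H.
  eapply Rle_lt_trans; [right|exact H].
  assert (0 < v ^ S k) by (apply pow_lt; lra). field. lra.
- intros x Hx. apply C1; [lia|lra].
- exact Cf.
- intros v Hv. destruct (Ef v Hv) as [Hu [-> Hp]].
  generalize (poisson_kernel_upper (1 - c) _ ltac:(lra) Hu). set (u := - ln v) in *. intros H.
  apply (Rmult_lt_compat_l _ _ _ Hp) in H.
  eapply Rlt_le_trans; [exact H|right].
  assert (0 < v ^ S k) by (apply pow_lt; lra). field. lra.
Qed.

Theorem theorem5 :
  forall (n nu : nat),
    (2 <= n)%nat -> (1 < nu < n)%nat ->
    - (2 * INR n / PI) * ln (2 * sin (PI * INR nu / INR n)) + A n nu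
      < cosec_sum n nu
      < - (2 * INR n / PI) * ln (2 * sin (PI * INR nu / INR n)) + B n nu.
Proof.
intros n nu Hn2 Hnu.
destruct n as [|[|N]]; [lia|lia|].
generalize (cosec_sum_RInt N nu ltac:(lia)). cbv zeta.
unfold A, B, csc.
assert (HN : (1 <= S N)%nat) by lia.
generalize (log_moment_1 (S N) HN) (log_moment_3_le (S N) HN).
set (n := INR (S (S N))). set (x := PI * INR nu / n). intros M1 M3 HI.
assert (Hn : 2 <= n).
{ change 2 with (INR 2). apply le_INR. lia. }
assert (Hpi := PI_RGT_0).
assert (Hx : 0 < x < PI).
{ assert (0 < INR nu < n) by (split; [apply lt_0_INR|apply lt_INR]; lia).
  unfold x. split.
  - apply Rdiv_lt_0_compat; nra.
  - apply Rmult_lt_reg_r with n; [lra|].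
    replace (PI * INR nu / n * n) with (PI * INR nu) by (field; lra). nra. }
assert (Hs : 0 < sin x) by (apply sin_gt_0; lra).
assert (Hc : -1 <= cos (2 * x) < 1).
{ split; [apply COS_bound|apply cos_lt_1; lra]. }
destruct (poisson_moment_bounds _ _ _ HN Hc HI) as [HL HU].
rewrite M1 in HL, HU.
assert (HL' : / (1 - cos (2 * x)) * (PI ^ 2 / (12 * n ^ 2)) -
  (2 + cos (2 * x)) / (6 * (1 - cos (2 * x)) ^ 2) * (7 * PI ^ 4 / (120 * n ^ 4)) <
  - ln (2 * sin x) - PI / (2 * n) * cosec_sum (S (S N)) nu).
(* The third moment enters with a negative sign and [2 + c > 0], so its upper bound is the one to
   insert. *)
{ eapply Rle_lt_trans; [|exact HL]. apply Rplus_le_compat_l, Ropp_le_contravar.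
  apply Rmult_le_compat_l; [|exact M3].
  apply Rdiv_le_0_compat; [lra|]. assert (0 < (1 - cos (2 * x)) ^ 2) by (apply pow_lt; lra).
  lra. }
clear HL M1 M3 HI HN.
assert (E1 : 1 - cos (2 * x) = 2 * sin x ^ 2) by (rewrite cos_2a_sin; ring).
assert (E2 : 2 + cos (2 * x) = 1 + 2 * cos x ^ 2) by (rewrite cos_2a_cos; ring).
rewrite E1 in HU. rewrite E1, E2 in HL'.
set (T := cosec_sum (S (S N)) nu) in *. set (L := ln (2 * sin x)) in *.
assert (Hf : 0 < 2 * n / PI) by (apply Rdiv_lt_0_compat; lra).
(* Multiplying by [2n / PI] isolates [- T]: the upper bound on the integral becomes the lower bound
   on the sum, and conversely. *)
apply (Rmult_lt_compat_l _ _ _ Hf) in HU.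
apply (Rmult_lt_compat_l _ _ _ Hf) in HL'.
replace (2 * n / PI * (- L - PI / (2 * n) * T)) with (- (2 * n / PI) * L - T)
  in HU, HL' by (field; lra).
replace (2 * n / PI * _) with (PI / (12 * n) * (/ sin x) ^ 2) in HU by (field; lra).
(* The constant is [2 * (1/24) * (7/120) = 7/1440], where 24 comes from [6 (2 sin^2 x)^2]. *)
replace (2 * n / PI * _) with (PI / (12 * n) * (/ sin x) ^ 2 -
  7 * PI ^ 3 / (1440 * n ^ 3) * (1 + 2 * cos x ^ 2) * (/ sin x) ^ 4) in HL' by (field; lra).
lra.
Qed.
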